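(* In the one-song iPod process, from any initial configuration, the average preference $M_t=\frac1N\sum_{i\in I}x_t(i)$ is a continuous-time martingale with respect to the filtration $(\mathfrak{F}_t)_{t\ge0}$ generated by $\{x_t(i)\}_{i\in I,\,t\ge 0}$.
   Context: One-song iPod process. Let $I$ be a set of $N\ge 2$ agents with meeting rates $\nu_{i,j}=\nu_{j,i}\ge 0$ for $i\ne j$ (and $\nu_{i,i}=0$), normalized so that $\sum_j\nu_{i,j}=1$ for every $i$. Fix $\eta\in(0,1)$. The state at time $t\ge0$ is $x_t=(x_t(i))_{i\in I}\in[0,1]^I$, with $x_0$ arbitrary. To each ordered pair $(i,j)$, $i\neq j$, is attached a Poisson process of rate $\nu_{i,j}$, all independent; its points are meeting times of $i$ and $j$. At a meeting time $t$ of $i$ and $j$, draw conditionally independent Bernoulli variables $B_i,B_j$ with success probabilities $x_{t-}(i),x_{t-}(j)$, and set $x_t(i)=(1-\eta)x_{t-}(i)+\eta B_j$, $x_t(j)=(1-\eta)x_{t-}(j)+\eta B_i$; all other agents are unchanged. Paths are càdlàg. *)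

(* Defs.v *)
From HB Require Import structures.
From mathcomp Require Import all_boot all_order all_algebra.
From mathcomp Require Import all_classical all_reals all_analysis.

Set Implicit Arguments.
Unset Strict Implicit.
Unset Printing Implicit Defensive.

Import Order.TTheory GRing.Theory Num.Theory.
Import numFieldNormedType.Exports.

Local Open Scope classical_set_scope.
Local Open Scope ring_scope.

Section Probability.
Context (R : realType) (d : measure_display) (Omega : measurableType d).
Context (P : probability Omega R).
Implicit Types (F : R -> set_system Omega) (G : set_system Omega).

Definition sigma_gen (d' : measure_display) (T : measurableType d') (K : Type)
    (D : set K) (X : K -> Omega -> T) : set_system Omega :=
  <<s \bigcup_(k in D) preimage_set_system setT (X k) measurable >>.

(* For sigma-algebras the product rule over all indices contains the one over
   each subfamily: take A k = setT for the indices left out. *)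
Definition mutually_independent (K : finType) (G : K -> set_system Omega) :=
  forall A : K -> set Omega, (forall k, G k (A k)) ->
    P (\bigcap_k A k) = (\prod_(k : K) P (A k))%E.

(* Y is a version of the conditional expectation E[X | G] *)
Definition is_cond_exp G (X Y : Omega -> R) : Prop :=
  [/\ forall U : set R, measurable U -> G (Y @^-1` U),
      P.-integrable setT (EFin \o Y)
    & forall A, G A ->
        (\int[P]_(w in A) (Y w)%:E = \int[P]_(w in A) (X w)%:E)%E].

Definition filtration F : Prop :=
  (forall t : R, 0 <= t -> sigma_algebra setT (F t) /\ F t `<=` measurable) /\
  (forall s t : R, 0 <= s <= t -> F s `<=` F t).

Record martingale F (M : R -> Omega -> R) : Prop := {
  martingale_filtration : filtration F;
  martingale_adapted : forall t : R, 0 <= t ->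
    forall U : set R, measurable U -> F t (M t @^-1` U);
  martingale_integrable : forall t : R, 0 <= t ->
    P.-integrable setT (EFin \o M t);
  martingale_cond_exp : forall s t : R, 0 <= s <= t ->
    is_cond_exp (F s) (M t) (M s) }.

Definition counting_process (N : R -> Omega -> nat) : Prop :=
  forall w, [/\ N 0 w = 0%N,
    forall s t : R, 0 <= s <= t -> (N s w <= N t w)%N
  & forall t : R, 0 <= t -> \forall u \near t^'+, N u w = N t w].

(* The mass function is written out because the library's poisson_pmf is
   constantly 1 at rate 0; here rate 0 gives a process without points. *)
Record poisson_process (rate : R) (N : R -> Omega -> nat) : Prop := {
  poisson_counting : counting_process N;
  poisson_independent : forall (n : nat) (t : nat -> R),
    0 <= t 0%N -> {homo t : i j / (i <= j)%N >-> i <= j} ->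
    mutually_independent (fun i : 'I_n =>
      preimage_set_system setT (fun w => (N (t i.+1) w - N (t i) w)%N)
        measurable);
  poisson_increment : forall (s t : R) (k : nat), 0 <= s <= t ->
    let m := rate * (t - s) in
    P [set w | (N t w - N s w)%N = k] = (expR (- m) * m ^+ k / k`!%:R)%:E }.

(* the point number n, counted from 0, of a counting process; +oo if none *)
Definition arrival (N : R -> Omega -> nat) (n : nat) (w : Omega) : \bar R :=
  ereal_inf [set t%:E | t in [set t : R | 0 <= t /\ (n < N t w)%N]].

End Probability.

Definition left_lim (R : realType) (f : R -> R) (t : R) : R :=
  lim (f s @[s --> t^'-]).

Definition cadlag (R : realType) (f : R -> R) : Prop :=
  (forall t : R, 0 <= t -> f s @[s --> t^'+] --> f t) /\
  (forall t : R, 0 < t -> cvg (f s @[s --> t^'-])).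

Record meeting_rates (R : realType) (I : finType) (nu : I -> I -> R) : Prop := {
  rates_sym : forall i j, nu i j = nu j i;
  rates_ge0 : forall i j, 0 <= nu i j;
  rates_diag : forall i, nu i i = 0;
  rates_sum : forall i, \sum_j nu i j = 1 }.

Definition opair (I : finType) := {e : I * I | e.1 != e.2}.

Section IPod.
Context (R : realType) (I : finType) (nu : I -> I -> R) (eta : R).
Context (d : measure_display) (Omega : measurableType d).
Context (P : probability Omega R).
(* For e = (i, j), the points of clock e are meeting times of i and j;
   at the point number n of clock e, B1 e n is B_i and B2 e n is B_j. *)
Context (clock : opair I -> R -> {RV P >-> nat}).
Context (B1 B2 : opair I -> nat -> {RV P >-> bool}).
Context (x : I -> R -> {RV P >-> R}).

Definition meeting (e : opair I) (n : nat) (w : Omega) : \bar R :=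
  arrival (fun t => clock e t) n w.

Definition natural_filtration (t : R) : set_system Omega :=
  sigma_gen [set ks : I * R | 0 <= ks.2 <= t] (fun ks => x ks.1 ks.2).

(* what is known just before the meeting: all the clocks, and the states at the
   times strictly before it *)
Definition pre_meeting (e : opair I) (n : nat) : set_system Omega :=
  <<s sigma_gen [set ft : opair I * R | 0 <= ft.2] (fun ft => clock ft.1 ft.2)
      `|` [set A | exists (k : I) (s : R) (U : set R),
             [/\ 0 <= s, measurable U
               & A = [set w | (s%:E < meeting e n w)%E /\ U (x k s w)]]] >>.

(* x_0 (index None) and the clocks *)
Definition exogenous (o : option (opair I)) : set_system Omega :=
  if o is Some e then sigma_gen [set t | 0 <= t] (fun t => clock e t)
  else sigma_gen setT (fun k => x k 0).

(* Distinct clocks almost surely have no common point and each clock almost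
   surely has unit jumps, so the update is prescribed at the times that are a
   point of one clock only, and simple; nothing is required of the agents who
   meet at the other, exceptional, times.
   The conditional law of the draws bears on the event that the meeting takes
   place. *)
Record ipod_process : Prop := {
  ipod_clocks : forall e : opair I, poisson_process P (nu (val e).1 (val e).2)
                            (fun t => clock e t);
  ipod_independent : mutually_independent P exogenous;
  ipod_range : forall k (t : R) w, 0 <= t -> 0 <= x k t w <= 1;
  ipod_cadlag : forall k w, cadlag (fun t => x k t w);
  ipod_draws : forall e n (a b : bool),
    let T := meeting e n in
    let xT k w := left_lim (fun s => x k s w) (fine (T w)) in
    is_cond_exp P (pre_meeting e n)
      (\1_[set w | [/\ (T w < +oo)%E, B1 e n w = a & B2 e n w = b]])
      (fun w => \1_[set w | (T w < +oo)%E] w *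
         (bernoulli_pmf (xT (val e).1 w) a * bernoulli_pmf (xT (val e).2 w) b));
  ipod_meet : forall w e n t, meeting e n w = t%:E ->
    (forall f m, meeting f m w = t%:E -> f = e /\ m = n) ->
    let i := (val e).1 in let j := (val e).2 in
    let xt k := left_lim (fun s => x k s w) t in
    x i t w = (1 - eta) * xt i + eta * (B2 e n w : nat)%:R /\
    x j t w = (1 - eta) * xt j + eta * (B1 e n w : nat)%:R;
  ipod_unchanged : forall w k (s t : R), 0 <= s <= t ->
    (forall e n (u : R), s < u <= t -> meeting e n w = u%:E ->
       k != (val e).1 /\ k != (val e).2) ->
    x k t w = x k s w }.

End IPod.

(* Main.v *)
(* For A in F_s, t |-> E[1_A M_t] has a quadratic modulus of continuity on
   [s, oo[ and is therefore constant.  Split Omega according to the moves of the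
   clocks over ]s, t]: if none moves, M_t = M_s; if a single clock e moves, by
   one, past its point number n, then M_t - M_s is the jump at that meeting, and
   the intersection of A with this event is known just before the meeting, so
   the jump has integral 0 over it; two or more points occur with probability
   O((t - s)^2), and |M_t - M_s| <= 1. *)
Require Import Defs.
From HB Require Import structures.
From mathcomp Require Import all_boot all_order all_algebra.
From mathcomp Require Import all_classical all_reals all_analysis.
From mathcomp Require Import measurable_realfun ring lra zify.

Set Implicit Arguments.
Unset Strict Implicit.
Unset Printing Implicit Defensive.

Import Order.TTheory GRing.Theory Num.Theory.
Import numFieldNormedType.Exports.

Local Open Scope classical_set_scope.
Local Open Scope ring_scope.

(** * Real functions, arrival times and countable decompositions *)

Lemma quadratic_modulus_constant (R : realType) (f : R -> R) (C s t : R) :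
  s <= t ->
  (forall u v, s <= u <= v -> v <= t -> `|f v - f u| <= C * (v - u) ^+ 2) ->
  f s = f t.
Proof.
move=> st fC; apply/esym/eqP; rewrite -subr_eq0 -normr_le0.
(* Cutting [[s, t]] into [q.+1] pieces of length [h] and summing the increments gives at most
   [q.+1 * C * h ^+ 2], which is [C * (t - s) ^+ 2 / q.+1]. A nonzero [f t - f s] would violate this
   for large [q]. *)
have bound (q : nat) : `|f t - f s| * q.+1%:R <= C * (t - s) ^+ 2.
  pose h : R := (t - s) / q.+1%:R.
  have h0 : 0 <= h by rewrite divr_ge0 ?subr_ge0.
  have hq : h * q.+1%:R = t - s by rewrite divfK.
  have step (k : nat) : (k <= q.+1)%N ->
      `|f (s + h * k%:R) - f s| <= k%:R * (C * h ^+ 2).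
    elim: k => [_|k IH kq]; first by rewrite mulr0 addr0 subrr normr0 mul0r.
    rewrite -natr1 [leRHS]mulrDl mul1r [leRHS]addrC.
    have -> : f (s + h * (k%:R + 1)) - f s =
      (f (s + h * (k%:R + 1)) - f (s + h * k%:R)) + (f (s + h * k%:R) - f s).
      by ring.
    apply: (le_trans (ler_normD _ _)); apply: lerD; last exact: IH (ltnW kq).
    have := fC (s + h * k%:R) (s + h * (k%:R + 1)).
    rewrite (_ : s + h * (k%:R + 1) - (s + h * k%:R) = h); last by ring.
    apply; first by rewrite lerDl mulr_ge0//= lerD2l ler_wpM2l// natr1 ler_nat.
    by rewrite -lerBrDl -hq ler_wpM2l// natr1 ler_nat.
  have := step _ (leqnn q.+1); rewrite hq (addrC s) subrK.
  rewrite -(ler_pM2r (ltr0Sn R q)) => /le_trans; apply.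
  rewrite -hq.
  have -> : q.+1%:R * (C * h ^+ 2) * q.+1%:R = C * (h * q.+1%:R) ^+ 2 by ring.
  exact: lexx.
rewrite leNgt; apply/negP => d0.
have [q] : exists q : nat, C * (t - s) ^+ 2 / `|f t - f s| < q.+1%:R.
  exists (Num.truncn (C * (t - s) ^+ 2 / `|f t - f s|)).
  by apply: truncnS_gt.
by rewrite ltr_pdivrMr// ltNge (mulrC q.+1%:R) bound.
Qed.

(** The infimum defining [arrival] is attained by right-continuity: if the count at [t] is at most
    [n], it stays so on some [[t, t + e[], which pushes the infimum up to at least [t + e]. *)
Lemma arrival_le (R : realType) d (Omega : measurableType d)
    (N : R -> Omega -> nat) n w (t : R) :
  counting_process N -> 0 <= t -> (arrival N n w <= t%:E)%E = (n < N t w)%N.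
Proof.
move=> /(_ w)[_ Nmono Ncont] t0; apply/idP/idP => [|nN]; last first.
  by apply: ge_ereal_inf; exists t%:E => //; exists t.
apply: contraTT; rewrite -leqNgt -ltNge => Nn.
have [e /= e0 eN] := Ncont t t0.
apply: (@lt_le_trans _ _ (t + e)%:E); first by rewrite lte_fin ltrDl.
apply/ereal_infP => _ [r [r0 nr] <-]; rewrite lee_fin leNgt; apply/negP => rte.
suff : (N r w <= n)%N by rewrite leqNgt nr.
have [rt|tr] := leP r t.
  by apply: leq_trans Nn; apply: Nmono; rewrite r0.
rewrite eN//= distrC ger0_norm; last by rewrite subr_ge0 ltW.
by rewrite ltrBlDl.
Qed.

(** No condition on [Q]: splitting on the value of [f] leaves a countable union. Since [T] is
    arbitrary, this also serves for generated sub-sigma-algebras. *)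
Lemma measurable_nat_rel d (T : measurableType d) (f g : T -> nat)
    (Q : nat -> nat -> Prop) :
  measurable_fun setT f -> measurable_fun setT g ->
  measurable [set w | Q (f w) (g w)].
Proof.
move=> mf mg.
have -> : [set w | Q (f w) (g w)] =
    \bigcup_a ((f @^-1` [set a]) `&` (g @^-1` [set b | Q a b])).
  apply/seteqP; split => [w Qw|w [a _ [/= <-]]]; last by [].
  by exists (f w).
apply: bigcupT_measurable => a; apply: measurableI.
  by rewrite -[X in measurable X]setTI; apply: mf.
by rewrite -[X in measurable X]setTI; apply: mg.
Qed.

Lemma integral_countable_eq0 d (T : measurableType d) (R : realType)
    (mu : {measure set T -> \bar R}) (K : countType) (F : K -> set T)
    (g : T -> \bar R) :
  (forall k, measurable (F k)) -> trivIset setT F ->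
  mu.-integrable (\bigcup_k F k) g ->
  (forall k, (\int[mu]_(w in F k) g w)%E = 0%E) ->
  (\int[mu]_(w in \bigcup_k F k) g w)%E = 0%E.
Proof.
move=> mF tF ig g0.
(* The family is re-indexed by natural numbers through pickling, with the empty set at numbers that
   code no [k]. *)
pose G m := if pickle_inv m is Some k then F k else set0.
have UG : \bigcup_k F k = \bigcup_m G m.
  apply/seteqP; split => w.
    by move=> [k _ Fk]; exists (pickle k) => //; rewrite /G pickleK_inv.
  by move=> [m _]; rewrite /G; case: pickle_inv => // k Fk; exists k.
rewrite UG integral_bigcup -?UG//.
- rewrite eseries0// => m _ _; rewrite /G; case: pickle_inv => [k|] //.
  by rewrite integral_set0.
- move=> m1 m2 _ _ [w []]; rewrite /G.
  case E1: pickle_inv => [k1|]//; case E2: pickle_inv => [k2|]// F1 F2.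
  have k12 : k1 = k2 by apply: tF => //; exists w.
  have := @pickle_invK K m1; have := @pickle_invK K m2.
  by rewrite E1 E2 k12 /= => -> ->.
- by move=> m; rewrite /G; case: pickle_inv.
Qed.

(** * Finite independent families and the union bound *)

Section FiniteFamilies.
Context (R : realType) (d : measure_display) (Omega : measurableType d).
Context (P : probability Omega R).

Lemma mutually_independent2 (K : finType) (G : K -> set_system Omega) a b A B :
  mutually_independent P G -> (forall k, G k setT) -> a != b ->
  G a A -> G b B -> P (A `&` B) = (P A * P B)%E.
Proof.
move=> ind GT ab GA GB; have ba : (b == a) = false by rewrite eq_sym (negbTE ab).
pose S k := if k == a then A else if k == b then B else setT.
have : P (\bigcap_k S k) = (\prod_k P (S k))%E.
  by apply: ind => k; rewrite /S; case: eqP => [->//|_]; case: eqP => [->|].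
rewrite (bigD1 a)//= (bigD1 b)/= ?ba// big1 => [|k /andP[ka kb]]; last first.
  by rewrite /S (negbTE ka) (negbTE kb) probability_setT.
rewrite mule1 /S ba !eqxx => <-; congr (P _).
apply/seteqP; split => [w [Aw Bw] k _|w Sw].
  by case: ifP => // _; case: ifP.
by split; [have := Sw a I|have := Sw b I]; rewrite ?ba eqxx.
Qed.

Lemma probability_bigcup_le (K : finType) (A : K -> set Omega) (r : K -> R) :
  (forall k, measurable (A k)) -> (forall k, (P (A k) <= (r k)%:E)%E) ->
  (P (\bigcup_k A k) <= (\sum_k r k)%:E)%E.
Proof.
move=> mA Ar.
have -> : \bigcup_k A k = \big[setU/set0]_k A k.
  rewrite -bigcup_seq; apply/seteqP; split => w [k _ Ak]; exists k => //=.
  exact: mem_index_enum.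
suff : measurable (\big[setU/set0]_k A k) /\
    (P (\big[setU/set0]_k A k) <= (\sum_k r k)%:E)%E by case.
(* Measurability of the partial unions is carried along the induction, as subadditivity requires
   it. *)
apply: (big_ind2 (fun B (b : R) => measurable B /\ (P B <= b%:E)%E)).
- by rewrite measure0.
- move=> B b C c [mB Bb] [mC Cc]; split; first exact: measurableU.
  rewrite EFinD; apply: (le_trans (measureU2 _ mB mC)).
  exact: leeD.
- by move=> k _; split.
Qed.

End FiniteFamilies.

(** * Tail bounds for Poisson increments *)

Section PoissonIncrements.
Context (R : realType) (d : measure_display) (Omega : measurableType d).
Context (P : probability Omega R).
Context (rate : R) (N : R -> {RV P >-> nat}).
Context (rate0 : 0 <= rate) (PN : poisson_process P rate (fun t => N t)).
Context (s t : R) (st : 0 <= s <= t).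

Let mS k : measurable [set w | (N t w - N s w)%N = k].
Proof. exact: (@measurable_nat_rel _ _ (N s) (N t) (fun a b => (b - a)%N = k)). Qed.

Let massE k : P [set w | (N t w - N s w)%N = k] =
  (expR (- (rate * (t - s))) * (rate * (t - s)) ^+ k / k`!%:R)%:E.
Proof. exact: (poisson_increment PN k st). Qed.

Let m0 : 0 <= rate * (t - s).
Proof. by rewrite mulr_ge0// subr_ge0; case/andP: st. Qed.

Lemma poisson_ge1_le :
  (P [set w | (1 <= N t w - N s w)%N] <= (rate * (t - s))%:E)%E.
Proof.
have -> : [set w | (1 <= N t w - N s w)%N] = ~` [set w | (N t w - N s w)%N = 0%N].
  apply/seteqP; split => w /=; first by case: (_ - _)%N.
  by case: (_ - _)%N.
rewrite probability_setC//; have -> := massE 0%N; rewrite expr0 mulr1 fact0 divr1.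
rewrite -EFinB lee_fin; have := expR_ge1Dx (- (rate * (t - s))); lra.
Qed.

Lemma poisson_ge2_le :
  (P [set w | (2 <= N t w - N s w)%N] <= ((rate * (t - s)) ^+ 2)%:E)%E.
Proof.
have -> : [set w | (2 <= N t w - N s w)%N] =
    ~` ([set w | (N t w - N s w)%N = 0%N] `|` [set w | (N t w - N s w)%N = 1%N]).
  apply/seteqP; split => w /=; first by case: (_ - _)%N => [|[|k]]// _ [].
  by case: (_ - _)%N => [|[|k]]// []; [left|right].
rewrite probability_setC; last exact: measurableU.
rewrite measureU//; last by apply/seteqP; split => // w [/= ->].
rewrite [X in (1 - (X + _))%E](massE 0%N) [X in (1 - (_ + X))%E](massE 1%N).
rewrite expr0 expr1 mulr1 fact0 !divr1.
rewrite -[X in (1 - X)%E]EFinD -EFinB lee_fin.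
(* With [m = rate * (t - s) >= 0], the inequality [expR (- m) >= 1 - m] gives [1 - expR (- m) * (1 +
   m) <= 1 - (1 - m) * (1 + m) = m ^+ 2]. *)
have := expR_ge1Dx (- (rate * (t - s))); have := m0.
set m := rate * _; nra.
Qed.

End PoissonIncrements.

(** * Generated sigma-algebras *)

Section SigmaGen.
Context (d : measure_display) (Omega : measurableType d).

(** Turns membership in a sub-sigma-algebra into measurability on [Omega] equipped with that
    sub-sigma-algebra, so that the closure lemmas for measurable functions apply to it. *)
Lemma measurable_fun_gen d' (T : measurableType d') (G : set_system Omega)
    (f : Omega -> T) :
  (forall U, measurable U -> <<s G >> (f @^-1` U)) ->
  measurable_fun (setT : set (g_sigma_algebraType G)) f.
Proof. by move=> Gf _ U mU; rewrite setTI; exact: Gf. Qed.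

Context (d' : measure_display) (T : measurableType d') (K : Type).
Context (D : set K) (X : K -> Omega -> T).

Lemma sigma_gen_preimage k U : D k -> measurable U -> sigma_gen D X (X k @^-1` U).
Proof.
move=> Dk mU; apply: sub_gen_smallest; exists k => //; exists U => //.
by rewrite setTI.
Qed.

Lemma sigma_gen_sub (S : set_system Omega) : sigma_algebra setT S ->
  (forall k U, D k -> measurable U -> S (X k @^-1` U)) -> sigma_gen D X `<=` S.
Proof.
move=> sS SX; apply: smallest_sub => // _ [k Dk [U mU <-]].
by rewrite setTI; exact: SX.
Qed.

Lemma sigma_gen_algebra : sigma_algebra setT (sigma_gen D X).
Proof. exact: smallest_sigma_algebra. Qed.

Lemma sigma_gen_setT : sigma_gen D X setT.
Proof.
have [s0 sC _] := sigma_gen_algebra.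
by rewrite -(setD0 setT); exact: sC.
Qed.

End SigmaGen.

(** * Moves of the clocks over []s, t]] *)

Section IPodProcess.
Context (R : realType) (I : finType) (nu : I -> I -> R) (eta : R).
Context (d : measure_display) (Omega : measurableType d).
Context (P : probability Omega R).
Context (clock : opair I -> R -> {RV P >-> nat}).
Context (B1 B2 : opair I -> nat -> {RV P >-> bool}).
Context (x : I -> R -> {RV P >-> R}).
Context (hnu : meeting_rates nu) (hx : ipod_process nu eta clock B1 B2 x).

Let rate (e : opair I) : R := nu (val e).1 (val e).2.

Lemma clock_counting e : counting_process (fun t => clock e t).
Proof. exact: poisson_counting (ipod_clocks hx e). Qed.

Lemma clock_mono e s t w : 0 <= s <= t -> (clock e s w <= clock e t w)%N.
Proof. by move=> st; have [_ + _] := clock_counting e w; exact. Qed.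

Lemma meeting_le e n w t : 0 <= t ->
  (meeting clock e n w <= t%:E)%E = (n < clock e t w)%N.
Proof. by move=> t0; rewrite /meeting arrival_le//; exact: clock_counting. Qed.

(** The index records the count [n] along with the clock [e], so that each event concerns one fixed
    [meeting e n], to which the law of the draws applies. The index type is countable. *)
Definition transition (o : option (opair I * nat)) (f : opair I) (a b : nat) :=
  if o is Some (e, n) then
    if f == e then a = n /\ b = n.+1 else b = a
  else b = a.

Definition transition_event s t o : set Omega :=
  \bigcap_f [set w | transition o f (clock f s w) (clock f t w)].

Lemma trivIset_transition_event s t : trivIset setT (transition_event s t).
Proof.
move=> o1 o2 _ _ [w [T1 T2]].
case: o1 o2 T1 T2 => [[e n]|] [[f m]|]// T1 T2.
- have := T1 e Logic.I; have := T2 e Logic.I; rewrite /transition/= eqxx.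
  by case: eqP => [->|_]; [case=> -> _ [->]|move=> -> [-> /n_Sn]].
- have := T1 e Logic.I; have := T2 e Logic.I; rewrite /transition/= eqxx.
  by move=> -> [-> /n_Sn].
- have := T1 f Logic.I; have := T2 f Logic.I; rewrite /transition/= eqxx.
  by move=> [-> ->] /esym/n_Sn.
Qed.

Lemma measurable_transition_event s t o : measurable (transition_event s t o).
Proof.
apply: fin_bigcap_measurable; first exact: finite_finset.
by move=> f _; exact: (measurable_nat_rel (transition o f)).
Qed.

(** [pre_meeting] contains the clocks at all times, later ones included, so the event is known
    before the meeting even when [t] lies after it. *)
Lemma transition_event_clocks e n s t o : 0 <= s -> 0 <= t ->
  pre_meeting clock x e n (transition_event s t o).
Proof.
move=> s0 t0.
have mclock f r : 0 <= r -> measurable_fun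
    (setT : set (g_sigma_algebraType
      (sigma_gen [set ft : opair I * R | 0 <= ft.2] (fun ft => clock ft.1 ft.2)
      `|` [set A | exists (k : I) (s : R) (U : set R),
             [/\ 0 <= s, measurable U
               & A = [set w | (s%:E < meeting clock e n w)%E /\ U (x k s w)]]])))
    (clock f r).
  move=> r0; apply: measurable_fun_gen => U mU; apply: sub_gen_smallest; left.
  exact: (@sigma_gen_preimage _ _ _ _ _ _ (fun ft => clock ft.1 ft.2) (f, r)).
apply: (@fin_bigcap_measurable _ (g_sigma_algebraType _)).
  exact: finite_finset.
move=> f _; apply: (measurable_nat_rel (transition o f)); exact: mclock.
Qed.

Lemma no_transition_le s t : 0 <= s <= t ->
  (P (~` \bigcup_o transition_event s t o) <=
   (\sum_p rate p.1 * rate p.2 * (t - s) ^+ 2)%:E)%E.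
Proof.
move=> st.
pose inc k f := [set w | (k <= clock f t w - clock f s w)%N].
have minc k f : measurable (inc k f).
  exact: (measurable_nat_rel (fun a b => (k <= b - a)%N)).
have rate0 e : 0 <= rate e by exact: rates_ge0 hnu _ _.
(* Outside all transition events, either one clock advances by at least two (diagonal pairs) or two
   distinct clocks advance. The first case costs a squared mean by the Poisson tail, the second a
   product of two means by independence of the clocks. *)
pose bad (p : opair I * opair I) :=
  if p.1 == p.2 then inc 2%N p.1 else inc 1%N p.1 `&` inc 1%N p.2.
have mbad p : measurable (bad p).
  by rewrite /bad; case: ifP => // _; exact: measurableI.
have cover : (~` \bigcup_o transition_event s t o) `<=` \bigcup_p bad p.
  move=> w noT; apply: contrapT => nobad; apply: noT.
  have inc2 f : (clock f t w - clock f s w < 2)%N.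
    rewrite ltnNge; apply/negP => f2; apply: nobad; exists (f, f) => //.
    by rewrite /bad eqxx.
  (* No clock advances by two, so an advancing clock [e] advances by exactly one, and a second
     advancing clock [f] would make the pair [(f, e)] bad. *)
  have [[e e1]|no1] := pselect (exists e, (1 <= clock e t w - clock e s w)%N).
    exists (Some (e, clock e s w)) => // f _ /=.
    rewrite /transition; have := inc2 f; have := @clock_mono f s t w st.
    case: eqP => [->|/eqP fe].
      by move=> _ _; have := inc2 e; move: e1; lia.
    have : ~ (1 <= clock f t w - clock f s w)%N.
      move=> f1; apply: nobad; exists (f, e) => //.
      by rewrite /bad/= (negbTE fe).
    lia.
  exists None => // f _; rewrite /transition/=.
  have := @clock_mono f s t w st.
  have : ~ (1 <= clock f t w - clock f s w)%N by move=> f1; apply: no1; exists f.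
  lia.
have mU : measurable (\bigcup_o transition_event s t o).
  apply: countable_bigcupT_measurable => [|o]; first exact: countableP.
  exact: measurable_transition_event.
apply: (@le_trans _ _ (P (\bigcup_p bad p))).
  apply: le_measure => //; rewrite inE//; first exact: measurableC.
  by apply: fin_bigcup_measurable => //; exact: finite_finset.
apply: probability_bigcup_le => // -[f g]; rewrite /bad/=; case: eqP => [<-|/eqP fg].
  rewrite (_ : rate f * rate f * (t - s) ^+ 2 = (rate f * (t - s)) ^+ 2); last by ring.
  exact: (poisson_ge2_le (rate0 f) (ipod_clocks hx f) st).
have exo h : exogenous clock x (Some h) (inc 1%N h).
  have mclock r : 0 <= r -> measurable_fun (setT : set (g_sigma_algebraType
      (\bigcup_(t in [set t | 0 <= t])
         preimage_set_system setT (clock h t) measurable))) (clock h r).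
    move=> r0; apply: measurable_fun_gen => V mV.
    exact: (@sigma_gen_preimage _ _ _ _ _ _ (fun t => clock h t)).
  have /andP[s0 st'] := st.
  apply: (measurable_nat_rel (fun a b => (1 <= b - a)%N) (mclock s s0)).
  exact: mclock (le_trans s0 st').
have -> : P (inc 1%N f `&` inc 1%N g) = (P (inc 1%N f) * P (inc 1%N g))%E.
  apply: (@mutually_independent2 _ _ _ _ _ _ (Some f) (Some g) _ _ (ipod_independent hx)).
  - by case=> [h|]; exact: sigma_gen_setT.
  - by apply: contra fg => /eqP[->].
  - exact: exo.
  - exact: exo.
rewrite (_ : rate f * rate g * (t - s) ^+ 2 =
  (rate f * (t - s)) * (rate g * (t - s))); last by ring.
rewrite EFinM; apply: lee_pmul => //.
  exact: (poisson_ge1_le (ipod_clocks hx f) st).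
exact: (poisson_ge1_le (ipod_clocks hx g) st).
Qed.

(** * A single meeting: the jump, and what is known before it *)

Lemma transition_event_lt e n s t w :
  transition_event s t (Some (e, n)) w -> 0 <= s -> (s%:E < meeting clock e n w)%E.
Proof.
move=> /(_ e Logic.I); rewrite /transition/= eqxx => -[sn _] s0.
by rewrite ltNge meeting_le// sn ltnn.
Qed.

(** The states are frozen on [[s, u[] and on [[u, t]], so left limits at [u] are values at [s]. Each
    agent receives the other's draw, but in the sum over agents the terms can be regrouped so that
    each draw is compared with its own success probability. *)
Lemma single_meeting e n s t w : 0 <= s <= t ->
  transition_event s t (Some (e, n)) w ->
  exists2 u, meeting clock e n w = u%:E &
    (forall k, left_lim (fun r => x k r w) u = x k s w) /\
    \sum_k x k t w - \sum_k x k s w =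
      eta * ((B2 e n w : nat)%:R - x (val e).2 s w +
             ((B1 e n w : nat)%:R - x (val e).1 s w)).
Proof.
move=> st Tw; have /andP[s0 st'] := st; have t0 : 0 <= t by lra.
have sT := transition_event_lt Tw s0.
have Tt : (meeting clock e n w <= t%:E)%E.
  have := Tw e Logic.I; rewrite /transition/= eqxx => -[_ tn].
  by rewrite meeting_le// tn.
case Tu : (meeting clock e n w) sT Tt => [u| |]//; rewrite lte_fin lee_fin => su ut.
(* Points are numbered from 0, so point [m] of [f] falls in []s, t]] exactly when
   [clock f s w <= m < clock f t w]; the transition leaves only [(e, n)]. *)
have only f m v : s < v <= t -> meeting clock f m w = v%:E -> f = e /\ m = n.
  move=> /andP[sv vt] fv.
  have mt : (m < clock f t w)%N by rewrite -meeting_le// fv lee_fin.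
  have ms : (clock f s w <= m)%N by rewrite leqNgt -meeting_le// fv lee_fin -ltNge.
  have := Tw f Logic.I; rewrite /transition/=; case: eqP => [fe [sn tn]|_]; last by lia.
  by subst f; split => //; lia.
have flat k r : s <= r < u -> x k r w = x k s w.
  move=> /andP[sr ru]; apply: (ipod_unchanged hx); first by rewrite s0.
  move=> f m v /andP[sv vr] fv.
  have [|fe mn] := only f m v _ fv; first by rewrite sv/=; lra.
  by move: fv; rewrite fe mn Tu => -[uv]; exfalso; lra.
have leftE k : left_lim (fun r => x k r w) u = x k s w.
  apply: cvg_lim; first exact: Rhausdorff.
  apply: cvg_near_cst; near=> r; apply: flat; apply/andP; split.
    by near: r; exact: nbhs_left_ge.
  by near: r; exact: nbhs_left_lt.
have afterE k : x k t w = x k u w.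
  apply: (ipod_unchanged hx); first by lra.
  move=> f m v /andP[uv vt] fv.
  have [|fe mn] := only f m v _ fv; first by apply/andP; split; lra.
  by move: fv; rewrite fe mn Tu => -[vu]; exfalso; lra.
exists u => //; split => //.
have [|xi xj] := ipod_meet hx Tu.
  by move=> f m; apply: only; rewrite su.
have others k : k != (val e).1 -> k != (val e).2 -> x k t w = x k s w.
  move=> ki kj; apply: (ipod_unchanged hx) => // f m v sv fv.
  by have [-> _] := only f m v sv fv.
rewrite -sumrB (bigD1 (val e).1)//= (bigD1 (val e).2)/=; last first.
  by rewrite eq_sym; exact: (valP e).
rewrite big1 => [|k /andP[ki kj]]; last by rewrite others// subrr.
rewrite !afterE xi xj !leftE; ring.
Unshelve. all: by end_near.
Qed.

(** On the event that the meeting comes after [s], every time [r <= s] is strictly before the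
    meeting, so the states at [r] are among the generators of [pre_meeting]. *)
Lemma natural_filtration_pre_meeting e n s A : 0 <= s ->
  natural_filtration x s A ->
  pre_meeting clock x e n (A `&` [set w | (s%:E < meeting clock e n w)%E]).
Proof.
move=> s0; set S := [set w | _].
have [p0 pD pU] : sigma_algebra setT (pre_meeting clock x e n).
  exact: smallest_sigma_algebra.
have pC B : pre_meeting clock x e n B -> pre_meeting clock x e n (~` B).
  by move=> pB; rewrite -setTD; exact: pD.
have pI B C : pre_meeting clock x e n B -> pre_meeting clock x e n C ->
    pre_meeting clock x e n (B `&` C).
  exact: (@measurableI _ (g_sigma_algebraType _)).
have preX k r U : 0 <= r -> measurable U -> pre_meeting clock x e n
    [set w | (r%:E < meeting clock e n w)%E /\ U (x k r w)].
  by move=> r0 mU; apply: sub_gen_smallest; right; exists k, r, U.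
(* The generators about states each mention an agent; any agent with [setT] yields [S]. *)
have pS : pre_meeting clock x e n S.
  have := preX (val e).1 s setT s0 measurableT.
  by congr (pre_meeting _ _ _ _ _); apply/seteqP; split => w // -[].
(* The sets whose trace on [S] is known before the meeting form a sigma-algebra, so it suffices to
   treat the generators. *)
move: A; apply: (@sigma_gen_sub _ _ _ _ _ _ _
  [set A | pre_meeting clock x e n (A `&` S)]).
  split => /=; first by rewrite set0I.
    move=> B pB; rewrite setTD.
    have -> : ~` B `&` S = ~` (B `&` S) `&` S.
      by rewrite setCI setIUl setICl setU0.
    by apply: pI => //; exact: pC.
  by move=> F pF; rewrite setI_bigcupl; exact: pU.
move=> [k r] U /= /andP[r0 rs] mU.
have -> : x k r @^-1` U `&` S =
    [set w | (r%:E < meeting clock e n w)%E /\ U (x k r w)] `&` S.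
  apply/seteqP; split => w [/=]; last by case.
  move=> Uw Sw; split => //; split => //.
  by apply: le_lt_trans Sw; rewrite lee_fin.
by apply: pI => //; exact: preX.
Qed.

Lemma natural_filtration_measurable s :
  0 <= s -> natural_filtration x s `<=` measurable.
Proof.
move=> s0; apply: sigma_gen_sub; first exact: sigma_algebra_measurable.
by move=> [k r] U _ mU /=; exact: measurable_funPTI.
Qed.

(** * Integrals of the increments of the average *)

Let avg t w : R := #|I|%:R^-1 * \sum_(i : I) x i t w.

Lemma avg_range t w : 0 <= t -> 0 <= avg t w <= 1.
Proof.
move=> t0; rewrite /avg mulr_ge0 ?sumr_ge0//=; last first.
  by move=> i _; case/andP: (ipod_range hx i w t0).
(* With no agents, the convention [0^-1 = 0] makes the average 0. *)
have [->|I0] := eqVneq #|I| 0%N; first by rewrite invr0 mul0r.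
rewrite mulrC ler_pdivrMr ?ltr0n ?lt0n// mul1r -sum1_card natr_sum.
by apply: ler_sum => i _; case/andP: (ipod_range hx i w t0).
Qed.

Lemma measurable_avg t : measurable_fun setT (avg t).
Proof.
by apply: measurable_funM => //; apply: measurable_sum => i; exact: measurable_funPT.
Qed.

Lemma integrable_avg D t : measurable D -> 0 <= t ->
  P.-integrable D (EFin \o avg t).
Proof.
move=> mD t0; apply: measurable_bounded_integrable => //.
- by rewrite (le_lt_trans (probability_le1 P mD))// ltry.
- exact: measurable_funTS (measurable_avg t).
- exists 1; split => // M M1 w _; have /andP[a0 a1] := avg_range w t0.
  by rewrite /= ger0_norm// (le_trans a1)// ltW.
Qed.

Lemma transition_integral_eq0 s t o A : 0 <= s <= t -> natural_filtration x s A ->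
  \int[P]_(w in A `&` transition_event s t o) (avg t w - avg s w) = 0.
Proof.
move=> st FA; have /andP[s0 st'] := st; have t0 : 0 <= t by lra.
(* For [None] there is no meeting in []s, t]], hence the integrand vanishes on the event. *)
case: o => [[e n]|]; last first.
  rewrite (@eq_Rintegral _ _ _ _ _ (cst 0)) ?Rintegral_cst ?mul0r//.
    apply: measurableI; last exact: measurable_transition_event.
    exact: natural_filtration_measurable FA.
  move=> w /[!inE] -[_ Tw]; rewrite /avg/= -mulrBr -sumrB big1 ?mulr0// => k _.
  apply/eqP; rewrite subr_eq0; apply/eqP; apply: (ipod_unchanged hx) => // f m v.
  move=> /andP[sv vt] fv; exfalso.
  have mt : (m < clock f t w)%N by rewrite -meeting_le// fv lee_fin.
  have ms : (clock f s w <= m)%N by rewrite leqNgt -meeting_le// fv lee_fin -ltNge.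
  by have := Tw f Logic.I; rewrite /transition/=; lia.
set D := A `&` _.
have mD : measurable D.
  apply: measurableI; last exact: measurable_transition_event.
  exact: natural_filtration_measurable FA.
have pD : pre_meeting clock x e n D.
  have -> : D = (A `&` [set w | (s%:E < meeting clock e n w)%E]) `&`
                transition_event s t (Some (e, n)).
    apply/seteqP; split => w; last by case => -[].
    by move=> [Aw Tw]; do 2?split => //; exact: transition_event_lt Tw s0.
  apply: (@measurableI _ (g_sigma_algebraType _)).
    exact: natural_filtration_pre_meeting.
  exact: transition_event_clocks.
(* Joint indicator of the draws minus its conditional probability, the latter written with the
   states at [s]. On [D] the meeting takes place and the left limits are these states, so
   [ipod_draws] gives [Z a b] integral 0 over [D]. *)
pose Z a b w : R := \1_[set w | B1 e n w = a /\ B2 e n w = b] w -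
  bernoulli_pmf (x (val e).1 s w) a * bernoulli_pmf (x (val e).2 s w) b.
have finT w : D w -> (meeting clock e n w < +oo)%E.
  by move=> [_ Tw]; have [u -> _] := single_meeting st Tw; rewrite ltry.
have Z0 a b : P.-integrable D (EFin \o Z a b) /\ \int[P]_(w in D) Z a b w = 0.
  have [_ iY YE] := ipod_draws hx e n a b.
  set Y := (Y in integrable _ _ (_ \o Y)) in iY YE.
  set J := \1_[set w | [/\ _, _ & _]] in YE.
  have iYD : P.-integrable D (EFin \o Y) by exact: integrableS iY.
  have iJ : P.-integrable D (EFin \o \1_[set w | B1 e n w = a /\ B2 e n w = b]).
    apply: (@integrableS _ _ _ _ setT) => //; apply: integrable_indic.
    by apply: measurableI; [exact: (measurable_funPTI (B1 e n) (Y := [set a]))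
                           |exact: (measurable_funPTI (B2 e n) (Y := [set b]))].
  have YDE w : D w -> Y w =
      bernoulli_pmf (x (val e).1 s w) a * bernoulli_pmf (x (val e).2 s w) b.
    move=> Dw; rewrite /Y indicE mem_set ?mul1r; last exact: finT.
    have [_ Tw] := Dw; have [u -> [leftE _]] := single_meeting st Tw.
    by rewrite /= !leftE.
  have iYs : P.-integrable D (EFin \o (fun w =>
      bernoulli_pmf (x (val e).1 s w) a * bernoulli_pmf (x (val e).2 s w) b)).
    by apply: eq_integrable iYD => // w /[!inE] Dw /=; rewrite YDE.
  split; first by apply: eq_integrable (integrableB mD iJ iYs).
  rewrite RintegralB//; apply/eqP; rewrite subr_eq0; apply/eqP.
  transitivity (\int[P]_(w in D) Y w); last first.
    by apply: eq_Rintegral => w /[!inE] Dw; rewrite YDE.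
  rewrite /Rintegral YE//; congr fine; apply: eq_integral => w /[!inE] Dw.
  rewrite /J !indicE; congr ((_ : bool)%:R%:E).
  by apply/idP/idP => /[!inE] => [[]|[_]]//; split => //; exact: finT.
pose c : R := #|I|%:R^-1 * eta.
(* Summing out the other draw recovers the marginals: [Z true true + Z true false] is [B1] minus its
   success probability, and [Z true true + Z false true] is the same for [B2]. Their sum times [c]
   is the jump of the average. *)
rewrite (@eq_Rintegral _ _ _ _ _
  (fun w => c * ((Z true true w + Z true false w) + (Z true true w + Z false true w)))).
  have [itt Itt] := Z0 true true; have [itf Itf] := Z0 true false.
  have [ift Ift] := Z0 false true.
  have i1 := integrableD mD itt itf; have i2 := integrableD mD itt ift.
  rewrite RintegralZl//; last by apply: eq_integrable (integrableD mD i1 i2).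
  rewrite RintegralD//.
  by rewrite (RintegralD mD itt itf) (RintegralD mD itt ift) Itt Itf Ift !addr0 mulr0.
move=> w /[!inE] -[_ Tw]; have [u _ [_ jump]] := single_meeting st Tw.
rewrite /avg -mulrBr jump mulrA -/c; congr (_ * _).
have memE a b : (w \in [set w0 | B1 e n w0 = a /\ B2 e n w0 = b]) =
    (B1 e n w == a) && (B2 e n w == b).
  apply/idP/andP => [/set_mem[/= -> ->]//|[/eqP wa /eqP wb]].
  by rewrite inE.
rewrite /Z !indicE !memE /bernoulli_pmf.
by case: (B1 e n w); case: (B2 e n w) => /=; ring.
Qed.

Lemma increment_bound s t A : 0 <= s <= t -> natural_filtration x s A ->
  `|\int[P]_(w in A) avg t w - \int[P]_(w in A) avg s w| <=
  (\sum_p rate p.1 * rate p.2) * (t - s) ^+ 2.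
Proof.
move=> st FA; have /andP[s0 st'] := st; have t0 : 0 <= t by lra.
have mA : measurable A := natural_filtration_measurable s0 FA.
pose H := \bigcup_o transition_event s t o.
have mH : measurable H.
  apply: countable_bigcupT_measurable => [|o]; first exact: countableP.
  exact: measurable_transition_event.
have mAH : measurable (A `&` H) by exact: measurableI.
have mAC : measurable (A `&` ~` H) by apply: measurableI => //; exact: measurableC.
have iD B : measurable B -> P.-integrable B (EFin \o (fun w => avg t w - avg s w)).
  move=> mB.
  exact: eq_integrable (integrableB mB (integrable_avg mB t0) (integrable_avg mB s0)).
rewrite -RintegralB//; [|exact: integrable_avg..].
rewrite -{1}(setIT A) -(setUv H) setIUr Rintegral_setU//; first last.
- by rewrite disj_set2E setIACA setICr setI0.
- by apply: iD; exact: measurableU.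
have -> : \int[P]_(w in A `&` H) (avg t w - avg s w) = 0.
  rewrite /Rintegral setI_bigcupr integral_countable_eq0//.
  - by move=> o; apply: measurableI => //; exact: measurable_transition_event.
  - exact/trivIset_setIl/trivIset_transition_event.
  - by rewrite -setI_bigcupr; exact: iD.
  - move=> o; have mAo : measurable (A `&` transition_event s t o).
      by apply: measurableI => //; exact: measurable_transition_event.
    (* A real integral equal to 0 settles the extended one only once finiteness is known, as [fine]
       sends the infinities to 0 too. *)
    rewrite -[LHS]fineK; last exact: integrable_fin_num (iD _ mAo).
    by rewrite [fine _]transition_integral_eq0.
rewrite add0r; apply: (le_trans (le_normr_Rintegral mAC (iD _ mAC))).
(* Both averages lie in [[0, 1]], so on the remaining event the increment is at most 1 in absolute
   value and its integral at most the probability of that event. *)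
apply: (@le_trans _ _ (\int[P]_(w in A `&` ~` H) cst 1 w)).
  apply: le_Rintegral => //.
  - exact: eq_integrable (integrable_norm (iD _ mAC)).
  - exact: finite_measure_integrable_cst.
  move=> w _; have := avg_range w s0; have := avg_range w t0.
  by rewrite ler_norml /cst; lra.
rewrite Rintegral_cst// mul1r -lee_fin fineK ?fin_num_measure//.
rewrite mulr_suml; apply: le_trans (no_transition_le st).
by apply: le_measure; rewrite ?inE//; exact: measurableC.
Qed.

(** * The martingale property *)

Lemma natural_filtration_filtration : filtration (natural_filtration x).
Proof.
split=> [t t0|s t /andP[s0 st]].
  by split; [exact: sigma_gen_algebra|exact: natural_filtration_measurable].
apply: sigma_gen_sub; first exact: sigma_gen_algebra.
move=> [k r] U /= /andP[r0 rs] mU.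
apply: (@sigma_gen_preimage _ _ _ _ _ _ (fun ks => x ks.1 ks.2) (k, r)) => //=.
by rewrite r0 (le_trans rs).
Qed.

Lemma natural_filtration_avg t U : 0 <= t -> measurable U ->
  natural_filtration x t (avg t @^-1` U).
Proof.
move=> t0 mU.
have : measurable_fun (setT : set (g_sigma_algebraType
    (\bigcup_(ks in [set ks : I * R | 0 <= ks.2 <= t])
       preimage_set_system setT (x ks.1 ks.2) measurable))) (avg t).
  apply: measurable_funM => //; apply: measurable_sum => i.
  apply: measurable_fun_gen => V mV.
  apply: (@sigma_gen_preimage _ _ _ _ _ _ (fun ks => x ks.1 ks.2) (i, t)) => //=.
  by rewrite t0 lexx.
by move=> /(_ measurableT U mU); rewrite setTI.
Qed.

Lemma avg_martingale : martingale P (natural_filtration x) avg.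
Proof.
split; first exact: natural_filtration_filtration.
- by move=> t t0 U; exact: natural_filtration_avg.
- by move=> t; exact: integrable_avg.
move=> s t /andP[s0 st]; split.
- by move=> U; exact: natural_filtration_avg.
- exact: integrable_avg.
move=> A FA; have t0 : 0 <= t by lra.
have mA : measurable A := natural_filtration_measurable s0 FA.
have finI r : 0 <= r -> (\int[P]_(w in A) (avg r w)%:E)%E \is a fin_num.
  by move=> r0; apply: integrable_fin_num => //; exact: integrable_avg.
rewrite -[LHS]fineK ?finI// -[RHS]fineK ?finI//; congr (_%:E).
(* The constant does not depend on the subinterval [[u, v]], and [A] lies in the sigma-algebra at
   [u] because [s <= u], so [increment_bound] applies from [u] on. *)
apply: (@quadratic_modulus_constant _ (fun r => \int[P]_(w in A) avg r w)
  (\sum_p rate p.1 * rate p.2) s t) => // u v /andP[su uv] vt.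
apply: increment_bound; first by rewrite uv (le_trans s0).
by apply: (natural_filtration_filtration.2 s u); rewrite ?s0.
Qed.

End IPodProcess.

Theorem proposition2p4 (R : realType) (I : finType) (nu : I -> I -> R) (eta : R)
    (d : measure_display) (Omega : measurableType d) (P : probability Omega R)
    (clock : opair I -> R -> {RV P >-> nat})
    (B1 B2 : opair I -> nat -> {RV P >-> bool})
    (x : I -> R -> {RV P >-> R})
    (hI : (2 <= #|I|)%N) (hnu : meeting_rates nu) (heta : 0 < eta < 1)
    (hx : ipod_process nu eta clock B1 B2 x) :
  martingale P (natural_filtration x)
    (fun t w => #|I|%:R^-1 * \sum_(i : I) x i t w).
Proof. exact: avg_martingale hnu hx. Qed.
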